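(* Consider the SAGD algorithm described in the context for minimizing $f(x)=\frac1n\sum_{i=1}^n f_i(x)$ over $x\in\mathbb{R}^d$. Assume that the functions $f_i$ are $L_i$-smooth and that $f$ is strongly convex with parameter $\mu>0$; let $x^*$ be its minimizer, $\overline{L}=\frac1n\sum_{i=1}^nL_i$ and $L_{\max}=\max_iL_i$. Consider the Lyapunov function $$\Psi^k=\|x^k-x^*\|_2^2+\frac{\theta\alpha}{2nL_{\max}}\|\mathbf{J}^k-\nabla\mathbf{F}(x^* )\|_F^2,$$ where $\theta=\frac{n}{q(\tau-1)+1}$. Let $$\mathcal{L}_1=\frac{1}{(q(\tau-1)+1)^2}\left(\left(q\left(\frac{\tau(n-\tau)}{n-1}-1\right)+1\right)L_{\max}+nq\,\frac{\tau(\tau-1)}{n-1}\,\overline{L}\right)$$ (known as the expected smoothness constant), and let $$\rho=\begin{cases}\theta^2\left(\frac{1-q}{n}+q\frac{\tau}{n}\frac{n-\tau}{n-1}\right), & q\theta^2\le\frac{n}{\tau}\frac{n-1}{\tau-1},\\[4pt] \theta^2\left(\frac{1-q}{n}+q\frac{\tau}{n}\frac{n-\tau}{n-1}\right)+n\left(\theta^2q\frac{\tau}{n}\frac{\tau-1}{n-1}-1\right), & q\theta^2\ge\frac{n}{\tau}\frac{n-1}{\tau-1}.\end{cases}$$ Choose $0\le q\le1$ and $\tau\in\{1,\dots,n\}$. If the stepsize is given by $$\alpha=\min\left\{\frac{1}{4\mathcal{L}_1},\ \frac{n}{4L_{\max}\rho+\mu\theta n}\right\},$$ then the expected total complexity in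 order to achieve $\epsilon$ accuracy, that is $\mathbb{E}[\Psi^k]\le\epsilon\Psi^0$, is $$\Omega^{q,\tau}=\left(q(\tau-1)+1\right)\max\left\{\frac{4\mathcal{L}_1}{\mu},\ \theta+\frac{4\rho L_{\max}}{\mu n}\right\}\log\left(\frac1\epsilon\right).$$
   Context: A function is $L$-smooth if its gradient is $L$-Lipschitz. $\nabla\mathbf{F}(x)=[\nabla f_1(x),\dots,\nabla f_n(x)]\in\mathbb{R}^{d\times n}$; $\|\cdot\|_F$ is the Frobenius norm; $\mathbf{J}_{:i}$ is the $i$-th column of $\mathbf{J}$. Here $n\ge2$, and for $\tau=1$ the threshold $\frac{n}{\tau}\frac{n-1}{\tau-1}$ is read as $+\infty$. SAGD algorithm with parameters $q\in[0,1]$, batch size $\tau$, stepsize $\alpha>0$: set $\theta=\frac{n}{q(\tau-1)+1}$, choose $x^0\in\mathbb{R}^d$ and initialize a table $\mathbf{J}^0\in\mathbb{R}^{d\times n}$. At iteration $k$, draw a random index set $I_k\subseteq\{1,\dots,n\}$: each subset of size $\tau$ is drawn with probability $q/\binom{n}{\tau}$ (minibatch SAGA step), and each singleton $\{j\}$ is drawn with probability $\frac{1-q}{n}$ (SAGA step). Then set $$x^{k+1}=x^k-\alpha\left[\frac{\theta}{n}\sum_{j\in I_k}\left(\nabla f_j(x^k)-\mathbf{J}^k_{:j}\right)+\frac1n\sum_{i=1}^n\mathbf{J}^k_{:i}\right],$$ and $\mathbf{J}^{k+1}_{:j}=\nabla f_j(x^k)$ if $j\in I_k$, $\mathbf{J}^{k+1}_{:j}=\mathbf{J}^k_{:j}$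 otherwise. The expected total complexity is the iteration count (to reach $\mathbb{E}[\Psi^k]\le\epsilon\Psi^0$) times the expected number $q(\tau-1)+1$ of gradients $\nabla f_i$ computed per iteration.
   Formalization: Each f_i is additionally assumed convex; without this the claim fails, e.g. for f_i(x)=x²/2 for half of the indices and -(1-2μ)x²/2 for the others with small μ, where E[Ψ^1] can exceed Ψ^0. *)

(* Defs.v *)
From HB Require Import structures.
From mathcomp Require Import all_boot all_order all_algebra.
From mathcomp Require Import all_classical all_reals all_analysis.

Set Implicit Arguments.
Unset Strict Implicit.
Unset Printing Implicit Defensive.

Import Order.TTheory GRing.Theory Num.Theory.
Import numFieldNormedType.Exports.

Local Open Scope ring_scope.

(* The library norm on matrices is the sup norm; this is the Frobenius norm,
   which on a column vector is the Euclidean norm. *)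
Definition fnorm (R : realType) (m n : nat) (A : 'M[R]_(m, n)) : R :=
  Num.sqrt (\sum_i \sum_j A i j ^+ 2).

Definition grad (R : realType) (d : nat) (f : 'cV[R]_d -> R) (x : 'cV[R]_d) :
    'cV[R]_d :=
  \col_i 'D_(delta_mx i 0) f x.

Definition gradF (R : realType) (d n : nat) (f : 'I_n -> 'cV[R]_d -> R)
    (x : 'cV[R]_d) : 'M[R]_(d, n) :=
  \matrix_(i, j) grad (f j) x i 0.

Definition smooth (R : realType) (d : nat) (L : R) (f : 'cV[R]_d -> R) : Prop :=
  (forall x, differentiable f x) /\
  (forall x y, fnorm (grad f x - grad f y) <= L * fnorm (x - y)).

Definition strongly_convex (R : realType) (d : nat) (mu : R)
    (f : 'cV[R]_d -> R) : Prop :=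
  forall (x y : 'cV[R]_d) (t : R), 0 <= t <= 1 ->
    f (t *: x + (1 - t) *: y) <=
    t * f x + (1 - t) * f y - mu / 2 * (t * (1 - t)) * fnorm (x - y) ^+ 2.

Definition mean (R : realType) (n : nat) (a : 'I_n -> R) : R :=
  n%:R^-1 * \sum_i a i.

Definition favg (R : realType) (d n : nat) (f : 'I_n -> 'cV[R]_d -> R)
    (x : 'cV[R]_d) : R :=
  mean (fun i => f i x).

(* Smoothness constants are nonnegative (as soon as d > 0), so starting the
   maximum from 0 is harmless. *)
Definition Lmax (R : realType) (n : nat) (L : 'I_n -> R) : R :=
  \big[Num.max/0]_i L i.

(* Closed form of the mean size of the random index set, expected_grads below. *)
Definition batch (R : realType) (q : R) (tau : nat) : R :=
  q * (tau%:R - 1) + 1.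

Definition theta (R : realType) (n : nat) (q : R) (tau : nat) : R :=
  n%:R / batch q tau.

(* Law of one random index set.  When tau = 1 the two kinds of step overlap on
   the singletons and their probabilities add up. *)
Definition draw_prob (R : realType) (n : nat) (q : R) (tau : nat)
    (S : {set 'I_n}) : R :=
  (if #|S| == tau then q / 'C(n, tau)%:R else 0) +
  (if #|S| == 1%N then (1 - q) / n%:R else 0).

(* Expectation under the product law: the k index sets are independent. *)
Definition Edraws (R : realType) (n : nat) (q : R) (tau k : nat)
    (X : k.-tuple {set 'I_n} -> R) : R :=
  \sum_(s : k.-tuple {set 'I_n}) (\prod_(t < k) draw_prob q tau (tnth s t)) * X s.

Definition sagd_step (R : realType) (d n : nat) (f : 'I_n -> 'cV[R]_d -> R)
    (q : R) (tau : nat) (alpha : R) (s : 'cV[R]_d * 'M[R]_(d, n))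
    (S : {set 'I_n}) : 'cV[R]_d * 'M[R]_(d, n) :=
  let: (x, J) := s in
  (x - alpha *: ((theta n q tau / n%:R) *:
                     (\sum_(j in S) (grad (f j) x - col j J)) +
                 n%:R^-1 *: (\sum_i col i J)),
   \matrix_(i, j) (if j \in S then grad (f j) x i 0 else J i j)).

Definition sagd_iter (R : realType) (d n : nat) (f : 'I_n -> 'cV[R]_d -> R)
    (q : R) (tau : nat) (alpha : R) (x0 : 'cV[R]_d) (J0 : 'M[R]_(d, n))
    (draws : seq {set 'I_n}) : 'cV[R]_d * 'M[R]_(d, n) :=
  foldl (sagd_step f q tau alpha) (x0, J0) draws.

Definition lyapunov (R : realType) (d n : nat) (f : 'I_n -> 'cV[R]_d -> R)
    (L : 'I_n -> R) (q : R) (tau : nat) (alpha : R) (xs : 'cV[R]_d)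
    (s : 'cV[R]_d * 'M[R]_(d, n)) : R :=
  fnorm (s.1 - xs) ^+ 2 +
  theta n q tau * alpha / (2 * n%:R * Lmax L) * fnorm (s.2 - gradF f xs) ^+ 2.

Definition expected_lyapunov (R : realType) (d n : nat)
    (f : 'I_n -> 'cV[R]_d -> R) (L : 'I_n -> R) (q : R) (tau : nat)
    (alpha : R) (xs x0 : 'cV[R]_d) (J0 : 'M[R]_(d, n)) (k : nat) : R :=
  Edraws q tau (fun s : k.-tuple {set 'I_n} =>
    lyapunov f L q tau alpha xs (sagd_iter f q tau alpha x0 J0 s)).

Definition expected_smoothness (R : realType) (n : nat) (L : 'I_n -> R)
    (q : R) (tau : nat) : R :=
  (batch q tau ^+ 2)^-1 *
  ((q * (tau%:R * (n%:R - tau%:R) / (n%:R - 1) - 1) + 1) * Lmax L +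
   n%:R * q * (tau%:R * (tau%:R - 1) / (n%:R - 1)) * mean L).

(* For tau = 1 the threshold of the case distinction is +oo. *)
Definition rho (R : realType) (n : nat) (q : R) (tau : nat) : R :=
  let th := theta n q tau in
  let r := th ^+ 2 * ((1 - q) / n%:R +
    q * (tau%:R / n%:R) * ((n%:R - tau%:R) / (n%:R - 1))) in
  if (tau == 1%N) ||
     (q * th ^+ 2 <= n%:R / tau%:R * ((n%:R - 1) / (tau%:R - 1)))
  then r
  else r + n%:R * (th ^+ 2 * q * (tau%:R / n%:R) *
                   ((tau%:R - 1) / (n%:R - 1)) - 1).

Definition stepsize (R : realType) (n : nat) (L : 'I_n -> R) (mu q : R)
    (tau : nat) : R :=
  Num.min (1 / (4 * expected_smoothness L q tau))
          (n%:R / (4 * Lmax L * rho n q tau + mu * theta n q tau * n%:R)).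

(* Expected number of gradients evaluated in one iteration. *)
Definition expected_grads (R : realType) (n : nat) (q : R) (tau : nat) : R :=
  \sum_(S : {set 'I_n}) draw_prob q tau S * #|S|%:R.

Definition expected_total_complexity (R : realType) (n : nat) (q : R)
    (tau k : nat) : R :=
  k%:R * expected_grads n q tau.

Definition Omega (R : realType) (n : nat) (L : 'I_n -> R) (mu q : R)
    (tau : nat) (eps : R) : R :=
  batch q tau *
  Num.max (4 * expected_smoothness L q tau / mu)
          (theta n q tau + 4 * rho n q tau * Lmax L / (mu * n%:R)) *
  ln (1 / eps).

(* Main.v *)
(** With D the gap f(x) - f(xs), strong convexity bounds <grad f(x), x - xs>
    below by D + mu/2 |x - xs|^2.  The search direction is unbiased and splits
    as A - B, where A samples grad f_i(x) - grad f_i(xs) and B is the centred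
    sample of the errors of the table.  Since |A - B|^2 <= 2|A|^2 + 2|B|^2, only
    the probabilities of {i in I} and {i, j in I} matter: cocoercivity of each
    f_i (constant L_max) and of f (mean constant) gives E|A|^2 <= 2 L_1 D, and
    rho is exactly the bound E|B|^2 <= (rho/n^2) |J - grad F(xs)|^2.  The weight of
    the table term in Psi is chosen so that the gaps produced by E|A|^2 and by
    the refreshed columns sum to at most the available -2 alpha D once
    alpha <= 1/(4 L_1); the other bound on alpha makes the table error contract.
    Hence E Psi^+ <= (1 - alpha mu) Psi, and 1/(alpha mu) is the maximum that
    appears in Omega. *)

Require Import Defs.
From HB Require Import structures.
From mathcomp Require Import all_boot all_order all_algebra all_fingroup.
From mathcomp Require Import all_classical all_reals all_analysis.
From mathcomp Require Import ring lra.
Import Order.TTheory GRing.Theory Num.Theory.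
Import numFieldNormedType.Exports.
Local Open Scope ring_scope.
Set Implicit Arguments.
Unset Strict Implicit.

(** * Moments of the random index set *)

Lemma sum_mem (R : realType) (I : finType) (S : {set I}) :
  \sum_i (i \in S)%:R = #|S|%:R :> R.
Proof. by rewrite -sum1_card natr_sum [RHS]big_mkcond; apply: eq_bigr => i _; case: ifP. Qed.

(** The symmetric group is 2-transitive. The second transposition fixes [k] because [k] differs from
    both points that it swaps. *)
Lemma perm_pair (T : finType) (i j k l : T) : i != j -> k != l ->
  exists2 s : {perm T}, s i = k & s j = l.
Proof.
move=> ij kl; exists (tperm i k * tperm (tperm i k j) l)%g.
  rewrite permM (tpermL i k) tpermD 1?(eq_sym l) // eq_sym.
  by rewrite -[X in X != _](tpermL i k) (inj_eq (@perm_inj _ _)).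
by rewrite permM tpermL.
Qed.

Section Sampling.
Variables (R : realType) (n : nat) (q : R) (tau : nat).
Hypotheses (hn : (2 <= n)%N) (hq : 0 <= q <= 1) (htau : (1 <= tau <= n)%N).

Local Notation p := (draw_prob q tau : {set 'I_n} -> R).

Lemma draw_prob_ge0 (S : {set 'I_n}) : 0 <= p S.
Proof.
case/andP: hq => q0 q1.
by rewrite /draw_prob addr_ge0//; case: ifP => // _;
  rewrite divr_ge0 ?ler0n ?subr_ge0.
Qed.

Lemma sum_uniform_card (phi : nat -> R) (c : R) (m : nat) : (m <= n)%N ->
  \sum_(S : {set 'I_n})
    (if #|S| == m then c / 'C(n, m)%:R else 0) * phi #|S| = c * phi m.
Proof.
move=> mn; rewrite (bigID (fun S : {set 'I_n} => #|S| == m)) /=.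
rewrite [X in _ + X]big1 ?addr0; last by move=> S /negPf ->; rewrite mul0r.
rewrite (eq_bigr (fun=> c / 'C(n, m)%:R * phi m)); last by move=> S /eqP ->; rewrite eqxx.
rewrite sumr_const (_ : #|_| = 'C(n, m)); last first.
  by have := card_draws 'I_n m; rewrite card_ord cardsE.
rewrite -mulr_natr; field.
by rewrite pnatr_eq0 -lt0n bin_gt0.
Qed.

(** The two uniform laws are summed separately, so their overlap on singletons at [tau] = 1 calls
    for no case distinction. *)
Lemma sum_draw_prob_card (phi : nat -> R) :
  \sum_(S : {set 'I_n}) p S * phi #|S| = q * phi tau + (1 - q) * phi 1%N.
Proof.
case/andP: htau => _ taun.
rewrite -(sum_uniform_card phi q taun) -(sum_uniform_card phi (1 - q) (ltnW hn)).
by rewrite -big_split; apply: eq_bigr => S _; rewrite /draw_prob bin1 mulrDl.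
Qed.

Lemma sum_draw_prob : \sum_(S : {set 'I_n}) p S = 1.
Proof.
have := sum_draw_prob_card (fun=> 1).
under eq_bigr do rewrite mulr1.
by move=> ->; ring.
Qed.

(* The law of the index set is exchangeable, so one- and two-point inclusion
   probabilities follow from the moments of its cardinality. *)
Lemma draw_prob_perm (s : {perm 'I_n}) (X : {set 'I_n} -> R) :
  \sum_(S : {set 'I_n}) p S * X [set s x | x in S] =
  \sum_(S : {set 'I_n}) p S * X S.
Proof.
rewrite [RHS](reindex_inj (imset_inj (@perm_inj _ s))) /=.
by apply: eq_bigr => S _; rewrite /draw_prob card_imset //; exact: perm_inj.
Qed.

Let n_neq0 : n%:R != 0 :> R.
Proof. by rewrite pnatr_eq0 -lt0n (ltnW hn). Qed.

Let n1_neq0 : n%:R - 1 != 0 :> R.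
Proof. by rewrite subr_eq0 pnatr_eq1 neq_ltn hn orbT. Qed.

(** By exchangeability all indices have the same inclusion probability, so [n] times it is the mean
    cardinality. *)
Lemma prob_mem (i : 'I_n) :
  \sum_(S : {set 'I_n}) p S * (i \in S)%:R = batch q tau / n%:R.
Proof.
have E (j : 'I_n) : \sum_(S : {set 'I_n}) p S * (j \in S)%:R =
    \sum_(S : {set 'I_n}) p S * (i \in S)%:R.
  rewrite -(draw_prob_perm (tperm i j)); apply: eq_bigr => S _.
  by rewrite -{1}(tpermL i j) mem_imset//; exact: perm_inj.
apply: (mulfI n_neq0); rewrite mulrC mulr_natr -[X in _ *+ X](card_ord n).
rewrite -sumr_const -(eq_bigr _ (fun j _ => E j)) exchange_big /=.
transitivity (\sum_(S : {set 'I_n}) p S * #|S|%:R).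
  apply: eq_bigr => S _; rewrite -mulr_sumr; congr (_ * _).
  exact: sum_mem.
rewrite (sum_draw_prob_card (fun m => m%:R)) /batch; field.
exact: n_neq0.
Qed.

(** Probability that two fixed distinct indices are drawn together; singleton draws contribute
    nothing. *)
Definition pair_prob : R :=
  q * (tau%:R * (tau%:R - 1)) / (n%:R * (n%:R - 1)).

(** By 2-transitivity the n(n - 1) ordered pairs of distinct indices are equally likely, and their
    probabilities add up to the mean of |S|^2 - |S|. *)
Lemma prob_mem_pair (i j : 'I_n) : i != j ->
  \sum_(S : {set 'I_n}) p S * ((i \in S)%:R * (j \in S)%:R) = pair_prob.
Proof.
move=> ij.
have E (k : 'I_n * 'I_n) : k.1 != k.2 ->
    \sum_(S : {set 'I_n}) p S * ((k.1 \in S)%:R * (k.2 \in S)%:R) =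
    \sum_(S : {set 'I_n}) p S * ((i \in S)%:R * (j \in S)%:R).
  case: k => k l /= kl.
  have [s si sj] := perm_pair ij kl.
  rewrite -(draw_prob_perm s); apply: eq_bigr => S _.
  by rewrite -{1}si -{1}sj !mem_imset//; exact: perm_inj.
have : \sum_(k : 'I_n * 'I_n | k.1 != k.2)
    \sum_(S : {set 'I_n}) p S * ((k.1 \in S)%:R * (k.2 \in S)%:R) =
    q * (tau%:R * (tau%:R - 1)).
  rewrite exchange_big /=.
  transitivity (\sum_(S : {set 'I_n}) p S * (#|S|%:R ^+ 2 - #|S|%:R)).
    apply: eq_bigr => S _; rewrite -mulr_sumr; congr (_ * _).
    have cS := sum_mem R S.
    apply: (addIr #|S|%:R); rewrite subrK -{1}cS.
    rewrite expr2 -{1}cS mulr_suml.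
    under [RHS]eq_bigr do rewrite -cS mulr_sumr.
    rewrite pair_big /= [RHS](bigID (fun k : 'I_n * 'I_n => k.1 != k.2)) /=.
    congr (_ + _).
    (* The diagonal contributes |S|, an indicator being its own square. *)
    rewrite (reindex (fun x : 'I_n => (x, x))) /=; last first.
      by exists fst => [//|[x y]] /=; rewrite inE /= negbK => /eqP ->.
    apply: eq_big => [x|x _]; first by rewrite eqxx.
    by case: (x \in S); rewrite /= ?mulr1 ?mulr0.
  by rewrite (sum_draw_prob_card (fun m => m%:R ^+ 2 - m%:R)); ring.
rewrite (eq_bigr _ E) sumr_const -[LHS]mulr_natr => H.
have C : #|[pred k : 'I_n * 'I_n | k.1 != k.2]|%:R = n%:R * (n%:R - 1) :> R.
  have : (#|[pred k : 'I_n * 'I_n | k.1 == k.2]| +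
     #|[predC [pred k : 'I_n * 'I_n | k.1 == k.2]]| = n * n)%N.
    by rewrite cardC card_prod card_ord.
  have -> : (#|[pred k : 'I_n * 'I_n | k.1 == k.2]| = n)%N.
    have dI : injective (fun x : 'I_n => (x, x)) by move=> x y [].
    rewrite -[RHS](card_ord n) -(card_codom dI).
    apply: eq_card => -[x y]; rewrite !inE; apply/eqP/codomP => /=.
      by move=> ->; exists y.
    by move=> [z [-> ->]].
  move=> /(congr1 (fun m => m%:R : R)); rewrite natrD natrM => H2.
  rewrite mulrBr mulr1 -H2 addrAC subrr add0r.
  by congr _%:R; apply: eq_card => -[x y]; rewrite !inE.
rewrite /pair_prob -C -H.
rewrite mulfK// C.
by rewrite mulf_neq0.
Qed.

Lemma mean_draw_sum (u : 'I_n -> R) :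
  \sum_(S : {set 'I_n}) p S * (\sum_(j in S) u j) =
  batch q tau / n%:R * \sum_j u j.
Proof.
rewrite mulr_sumr (eq_bigr (fun S => \sum_j u j * (p S * (j \in S)%:R))); last first.
  move=> S _; rewrite big_mkcond mulr_sumr; apply: eq_bigr => j _.
  by case: (j \in S); rewrite ?mulr1 ?mulr0 // mulrC.
rewrite exchange_big; apply: eq_bigr => j _ /=.
by rewrite -mulr_sumr prob_mem mulrC.
Qed.

(** In the expanded square, diagonal terms carry the one-point probability and the others
    [pair_prob]; regrouping restores the full square. *)
Lemma mean_draw_sum_sqr (u : 'I_n -> R) :
  \sum_(S : {set 'I_n}) p S * (\sum_(j in S) u j) ^+ 2 =
  (batch q tau / n%:R - pair_prob) * (\sum_j u j ^+ 2) +
  pair_prob * (\sum_j u j) ^+ 2.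
Proof.
transitivity (\sum_i \sum_j (u i * u j) *
   \sum_(S : {set 'I_n}) p S * ((i \in S)%:R * (j \in S)%:R)).
  under [RHS]eq_bigr do under eq_bigr do rewrite mulr_sumr.
  under [RHS]eq_bigr do rewrite exchange_big /=.
  rewrite exchange_big /=; apply: eq_bigr => S _.
  rewrite expr2 big_mkcond mulr_suml mulr_sumr; apply: eq_bigr => i _.
  rewrite !mulr_sumr; apply: eq_bigr => j _.
  by case: (i \in S); case: (j \in S); rewrite /=; ring.
rewrite [RHS](_ : _ = batch q tau / n%:R * (\sum_j u j ^+ 2) +
  pair_prob * ((\sum_j u j) ^+ 2 - \sum_j u j ^+ 2)); last by ring.
have -> : (\sum_j u j) ^+ 2 - \sum_j u j ^+ 2 = \sum_i \sum_(j | j != i) u i * u j.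
  rewrite expr2 mulr_suml -sumrB; apply: eq_bigr => i _.
  by rewrite mulr_sumr (bigD1 i) //= expr2 addrC addrK.
rewrite !mulr_sumr -big_split; apply: eq_bigr => i _ /=.
rewrite (bigD1 i) //=; congr (_ + _).
  rewrite -expr2 mulrC; congr (_ * _); rewrite -(prob_mem i).
  by apply: eq_bigr => S _; case: (i \in S); rewrite /= ?mulr1 ?mulr0.
rewrite mulr_sumr; apply: eq_bigr => j ij.
by rewrite prob_mem_pair 1?eq_sym // mulrC.
Qed.

End Sampling.

(** * Convexity and smoothness *)

Definition dot (R : realType) (d : nat) (u v : 'cV[R]_d) : R :=
  \sum_i u i 0 * v i 0.

Section Dot.
Variables (R : realType) (d : nat).
Implicit Types u v w : 'cV[R]_d.

Lemma dotC u v : dot u v = dot v u.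
Proof. by apply: eq_bigr => i _; rewrite mulrC. Qed.

Lemma dotDl u v w : dot (u + v) w = dot u w + dot v w.
Proof. by rewrite -big_split; apply: eq_bigr => i _; rewrite mxE mulrDl. Qed.

Lemma dotZl a u v : dot (a *: u) v = a * dot u v.
Proof. by rewrite mulr_sumr; apply: eq_bigr => i _; rewrite mxE mulrA. Qed.

Lemma dot0l u : dot 0 u = 0.
Proof. by rewrite -(scale0r u) dotZl mul0r. Qed.

Lemma dotNl u v : dot (- u) v = - dot u v.
Proof. by rewrite -scaleN1r dotZl mulN1r. Qed.

Lemma dotBl u v w : dot (u - v) w = dot u w - dot v w.
Proof. by rewrite dotDl dotNl. Qed.

Lemma dot_suml (I : finType) (F : I -> 'cV[R]_d) v :
  dot (\sum_i F i) v = \sum_i dot (F i) v.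
Proof.
rewrite exchange_big; apply: eq_bigr => i _.
by rewrite summxE mulr_suml.
Qed.

Lemma dotZr a u v : dot u (a *: v) = a * dot u v.
Proof. by rewrite !(dotC u) dotZl. Qed.

Lemma dotNr u v : dot u (- v) = - dot u v.
Proof. by rewrite !(dotC u) dotNl. Qed.

Lemma dotBr u v w : dot w (u - v) = dot w u - dot w v.
Proof. by rewrite !(dotC w) dotBl. Qed.

Lemma dot_ge0 u : 0 <= dot u u.
Proof. by apply: sumr_ge0 => i _; rewrite -expr2 sqr_ge0. Qed.

Lemma dot_eq0 u : (dot u u == 0) = (u == 0).
Proof.
apply/eqP/eqP => [|->]; last by rewrite /dot big1 // => i _; rewrite mxE mul0r.
move=> /psumr_eq0P u0; apply/matrixP => i j; rewrite !mxE ord1; apply/eqP.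
by rewrite -sqrf_eq0 expr2 u0 // => k _; rewrite -expr2 sqr_ge0.
Qed.

Lemma fnorm_sqr (m n : nat) (A : 'M[R]_(m, n)) :
  fnorm A ^+ 2 = \sum_i \sum_j A i j ^+ 2.
Proof.
by rewrite sqr_sqrtr // sumr_ge0 // => i _; rewrite sumr_ge0 // => j _; rewrite sqr_ge0.
Qed.

Lemma fnorm_ge0 (m n : nat) (A : 'M[R]_(m, n)) : 0 <= fnorm A.
Proof. exact: sqrtr_ge0. Qed.

Lemma fnorm_dot u : fnorm u ^+ 2 = dot u u.
Proof. by rewrite fnorm_sqr; apply: eq_bigr => i _; rewrite big_ord1 expr2. Qed.

(** Cauchy-Schwarz: expand the square of |v| u - |u| v and cancel |u||v|, hence the separate zero
    cases. *)
Lemma dot_le_fnorm u v : dot u v <= fnorm u * fnorm v.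
Proof.
have [u0|u0] := eqVneq u 0.
  by rewrite u0 dot0l mulr_ge0 ?fnorm_ge0.
have [v0|v0] := eqVneq v 0.
  by rewrite v0 dotC dot0l mulr_ge0 ?fnorm_ge0.
have a0 : 0 < fnorm u.
  by rewrite lt0r fnorm_ge0 andbT -sqrf_eq0 fnorm_dot dot_eq0.
have b0 : 0 < fnorm v.
  by rewrite lt0r fnorm_ge0 andbT -sqrf_eq0 fnorm_dot dot_eq0.
have := dot_ge0 (fnorm v *: u - fnorm u *: v).
rewrite !dotBl !dotBr !dotZl !dotZr -!fnorm_dot (dotC v u) => H.
rewrite -(ler_pM2l (mulr_gt0 a0 b0)); nra.
Qed.

End Dot.

Section Descent.
Variables (R : realType) (d : nat).
Implicit Types (f : 'cV[R]_d -> R) (G : 'cV[R]_d -> 'cV[R]_d) (x v : 'cV[R]_d).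

Definition has_grad f G :=
  forall x v, is_derive x v f (dot (G x) v).

Lemma differentiable_has_grad f :
  (forall x, differentiable f x) -> has_grad f (grad f).
Proof.
move=> df x v; apply: DeriveDef; first exact: diff_derivable.
rewrite deriveE // {1}(matrix_sum_delta v) raddf_sum /=.
apply: eq_bigr => i _; rewrite big_ord1 linearZ /= mxE deriveE // mulrC.
by [].
Qed.

(** The difference quotient along the line is that of [f] in direction [v], which replaces a chain
    rule. *)
Lemma is_derive_line f G x v (t : R) : has_grad f G ->
  is_derive t 1 (fun s : R => f (x + s *: v)) (dot (G (x + t *: v)) v).
Proof.
move=> fG.
have E : (fun h : R => h^-1 *: (((fun s : R => f (x + s *: v)) \o shift t) (h *: 1) -
     f (x + t *: v))) =
   (fun h : R => h^-1 *: ((f \o shift (x + t *: v)) (h *: v) - f (x + t *: v))).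
  apply/funext => h /=; congr (_ *: (f _ - _)).
  by rewrite [h *: 1]mulr1 scalerDl addrCA.
have [D1 D2] := fG (x + t *: v) v.
apply: DeriveDef; first by rewrite /derivable E.
by rewrite /derive E.
Qed.


Lemma is_derive_quadratic (a b t : R) :
  is_derive t 1 (fun s : R => a * s + b * s ^+ 2) (a + 2 * b * t).
Proof.
have Did := is_derive_id t (1 : R).
apply: (is_derive_eq (is_deriveD (is_deriveZ a Did) (is_deriveZ b (is_deriveX 2 Did)))).
rewrite /GRing.scale /= expr1; ring.
Qed.

Lemma slope_convex (g : R -> R) (g' c : R) : is_derive (0 : R) (1 : R) g g' ->
  (forall t, 0 < t < 1 -> g t <= (1 - t) * g 0 + t * c) -> g' <= c - g 0.
Proof.
move=> [gD <-] gc.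
have D : ((fun h : R => h^-1 *: ((g \o shift 0) (h *: 1) - g 0)) @ 0^'+ --> 'D_1 g 0)%classic.
  exact: cvg_dnbhs_at_right.
apply: (cvgr_to_le D).
near=> h.
have h0 : 0 < h by near: h; exact: nbhs_right_gt.
have h1 : h < 1 by near: h; exact: nbhs_right_lt.
rewrite /= addr0 [h *: 1]mulr1 [_ *: _]mulrC ler_pdivrMr //.
have := gc h; rewrite h0 h1 => /(_ isT); lra.
Unshelve. all: by end_near.
Qed.

(** Removing the quadratic from the restriction to the segment leaves a function below its chord,
    since t(1 - t) + t^2 = t. With [mu] = 0 this is the tangent inequality of convexity. *)
Lemma strongly_convex_grad (mu : R) f G x y :
  has_grad f G -> strongly_convex mu f ->
  f x + dot (G x) (y - x) + mu / 2 * dot (y - x) (y - x) <= f y.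
Proof.
move=> fG fmu; set v := y - x.
pose g := (fun t : R => f (x + t *: v)) - (fun t => 0 * t + (mu / 2 * dot v v) * t ^+ 2).
have Dg : is_derive (0 : R) (1 : R) g (dot (G x) v).
  have := is_deriveB (is_derive_line x v 0 fG) (is_derive_quadratic 0 (mu / 2 * dot v v) 0).
  by move/is_derive_eq; apply; rewrite scale0r addr0 mulr0 addr0 subr0.
have g0 : g 0 = f x by rewrite /g !fctE /= scale0r addr0; ring.
have := @slope_convex g (dot (G x) v) (f y - mu / 2 * dot v v) Dg.
rewrite g0 => H; suff: dot (G x) v <= f y - mu / 2 * dot v v - f x by lra.
apply: H => t /andP[t0 t1].
have t01 : 0 <= t <= 1 by rewrite !ltW.
have := fmu y x t t01; rewrite fnorm_dot -/v.
have -> : t *: y + (1 - t) *: x = x + t *: v.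
  by rewrite /v scalerBr scalerBl scale1r addrCA.
rewrite /g !fctE /=; lra.
Qed.

(** Mean value theorem for [f] minus its quadratic majorant on the segment: Cauchy-Schwarz and the
    Lipschitz bound make the derivative nonpositive. *)
Lemma descent_lemma (L : R) f G x y : has_grad f G ->
  (forall u w, fnorm (G u - G w) <= L * fnorm (u - w)) ->
  f y <= f x + dot (G x) (y - x) + L / 2 * dot (y - x) (y - x).
Proof.
move=> fG GL; set v := y - x.
pose g := (fun t : R => f (x + t *: v)) -
  (fun t => dot (G x) v * t + (L / 2 * dot v v) * t ^+ 2).
pose g' t := dot (G (x + t *: v)) v - (dot (G x) v + 2 * (L / 2 * dot v v) * t).
have Dg t : is_derive t (1 : R) g (g' t).
  exact: is_deriveB (is_derive_line x v t fG) (is_derive_quadratic _ _ _).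
have [|c c01] := @MVT R g g' 0 1 ltr01 (fun t _ => Dg t).
  by apply: derivable_within_continuous => s _; have [] := Dg s.
rewrite subr0 mulr1 => gE; suff : g 1 - g 0 <= 0.
  have xy : x + v = y by rewrite /v addrC subrK.
  rewrite /g !fctE /= scale0r addr0 scale1r xy; lra.
move: c01; rewrite in_itv /= => /andP[c0 c1].
rewrite gE /g'; suff : dot (G (x + c *: v) - G x) v <= L * c * dot v v.
  by rewrite dotBl; lra.
apply: (le_trans (dot_le_fnorm _ _)).
have := GL (x + c *: v) x; rewrite [x + _]addrC addrK.
have -> : fnorm (c *: v) = c * fnorm v.
  apply: (@pexpIrn _ 2) => //; rewrite ?nnegrE ?mulr_ge0 ?fnorm_ge0 ?(ltW c0) //.
  by rewrite exprMn !fnorm_dot dotZl dotZr; ring.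
move=> H; rewrite -fnorm_dot expr2 !mulrA -[L * c * _]mulrA.
exact: ler_wpM2r (fnorm_ge0 _) _ _ H.
Qed.

(** At [x - L^-1 *: a] the descent bound from [x] meets the tangent bound from [y]. Both are
    hypotheses, so that the lemma serves each [f i] and their mean with different constants. *)
Lemma cocoercive (L : R) f G x y : 0 < L ->
  (forall u w, f w + dot (G w) (u - w) <= f u) ->
  (forall u w, f u <= f w + dot (G w) (u - w) + L / 2 * dot (u - w) (u - w)) ->
  dot (G x - G y) (G x - G y) <= 2 * L * (f x - f y - dot (G y) (x - y)).
Proof.
move=> L0 fc fL; set a := G x - G y.
have H1 := fL (x - L^-1 *: a) x.
have H2 := fc (x - L^-1 *: a) y.
move: H1 H2; rewrite [x - _ - x]addrAC subrr add0r [x - _ - y]addrAC.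
rewrite [dot (G y) _]dotBr !dotNr dotNl opprK dotZl !dotZr.
have E : dot (G x) a - dot (G y) a = dot a a by rewrite -dotBl.
set q := dot (G y) (x - y); set s := dot a a in E *.
move=> H1 H2.
have LV : L^-1 * L = 1 by rewrite mulVf // gt_eqF.
have H3 : L^-1 * s <= 2 * (f x - f y - q).
  have E2 : L / 2 * (L^-1 * (L^-1 * s)) = L^-1 * s / 2.
    by field; rewrite gt_eqF.
  have E3 : L^-1 * dot (G x) a - L^-1 * dot (G y) a = L^-1 * s by rewrite -mulrBr E.
  move: H1 H2 E3; rewrite E2. lra.
have := ler_wpM2l (ltW L0) H3; rewrite mulrA mulfV ?gt_eqF // mul1r; lra.
Qed.

End Descent.

(** * One step of the algorithm *)

Section StepMoments.
Variables (R : realType) (n : nat) (q : R) (tau : nat).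
Hypotheses (hn : (2 <= n)%N) (hq : 0 <= q <= 1) (htau : (1 <= tau <= n)%N).

Local Notation p := (draw_prob q tau : {set 'I_n} -> R).
Local Notation b := (batch q tau).
Local Notation P2 := (pair_prob n q tau).
Local Notation th := (theta n q tau).

Let n_ge2 : 2 <= n%:R :> R. Proof. by rewrite ler_nat. Qed.
Let tau_ge1 : 1 <= tau%:R :> R.
Proof. by rewrite ler1n; case/andP: htau. Qed.
Let tau_len : tau%:R <= n%:R :> R.
Proof. by rewrite ler_nat; case/andP: htau. Qed.

Lemma batch_ge1 : 1 <= b.
Proof.
by case/andP: hq => q0 _; rewrite /batch lerDr mulr_ge0 // subr_ge0.
Qed.

Lemma batch_le : b <= n%:R.
Proof.
case/andP: hq => q0 q1; rewrite /batch.
apply: (@le_trans _ _ (tau%:R - 1 + 1)); last by rewrite subrK.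
by rewrite lerD2r ler_piMl // subr_ge0.
Qed.

Let n_neq0 : n%:R != 0 :> R. Proof. by apply/eqP => E; move: n_ge2; rewrite E; lra. Qed.
Let n1_neq0 : n%:R - 1 != 0 :> R. Proof. by apply/eqP; move: n_ge2; lra. Qed.
Let b_neq0 : b != 0.
Proof. by rewrite gt_eqF // (lt_le_trans ltr01) // batch_ge1. Qed.

Lemma theta_ge1 : 1 <= th.
Proof.
by rewrite /theta ler_pdivlMr ?mul1r ?batch_le // (lt_le_trans ltr01) // batch_ge1.
Qed.

(** Keeps the weight of the sum of squares in [mean_draw_sum_sqr] nonnegative, so that upper bounds
    can be inserted there. *)
Lemma pair_prob_le : P2 <= b / n%:R.
Proof.
case/andP: hq => q0 q1.
rewrite -subr_ge0.
have -> : b / n%:R - P2 =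
    ((1 - q) + q * (tau%:R * (n%:R - tau%:R) / (n%:R - 1))) / n%:R.
  by rewrite /batch /pair_prob; field; rewrite n_neq0 n1_neq0.
rewrite divr_ge0 ?ler0n // addr_ge0 ?subr_ge0 // mulr_ge0 // divr_ge0 //.
  by rewrite mulr_ge0 ?ler0n // subr_ge0.
by move: n_ge2; lra.
Qed.

Lemma pair_prob_ge0 : 0 <= P2.
Proof.
case/andP: hq => q0 q1.
rewrite /pair_prob divr_ge0 // mulr_ge0 // ?mulr_ge0 ?ler0n ?subr_ge0 //.
by move: n_ge2; lra.
Qed.

(** Applied to each coordinate, with [y] the offset from the minimizer, [a] the gradient differences
    and [h] the table errors. The last bracket bears the variance of the sampled table error. *)
Lemma mean_coord_step (y al : R) (a h : 'I_n -> R) :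
  \sum_(S : {set 'I_n}) p S *
     (y - al * (th / n%:R * (\sum_(j in S) (a j - h j)) + n%:R^-1 * \sum_j h j)) ^+ 2
  <= y ^+ 2 - 2 * al * (n%:R^-1 * (y * \sum_j a j)) +
     2 * al ^+ 2 * ((th / n%:R) ^+ 2 *
       ((b / n%:R - P2) * (\sum_j a j ^+ 2) + P2 * (\sum_j a j) ^+ 2)) +
     2 * al ^+ 2 * ((th / n%:R) ^+ 2 *
       ((b / n%:R - P2) * (\sum_j h j ^+ 2) + P2 * (\sum_j h j) ^+ 2) -
       (n%:R^-1 * \sum_j h j) ^+ 2).
Proof.
set H := \sum_j h j; set A := \sum_j a j; set c := th / n%:R.
pose sa (S : {set 'I_n}) := \sum_(j in S) a j.
pose sh (S : {set 'I_n}) := \sum_(j in S) h j.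
apply: (@le_trans _ _ (\sum_(S : {set 'I_n}) (
   (y ^+ 2 - 2 * al * y * (H / n%:R) + 2 * al ^+ 2 * (H / n%:R) ^+ 2) * p S +
   (- (2 * al * y * c)) * (p S * sa S) +
   (2 * al * y * c - 4 * al ^+ 2 * c * (H / n%:R)) * (p S * sh S) +
   (2 * al ^+ 2 * c ^+ 2) * (p S * (sa S) ^+ 2) +
   (2 * al ^+ 2 * c ^+ 2) * (p S * (sh S) ^+ 2)))).
  apply: ler_sum => S _.
  rewrite sumrB -/(sa S) -/(sh S) -subr_ge0.
  (* With A, B the two parts of the direction, this is
     2A^2 + 2B^2 - (A - B)^2 = (A + B)^2. *)
  set X := (X in 0 <= X).
  have -> : X = p S * (al ^+ 2 * (c * sa S + (c * sh S - H / n%:R)) ^+ 2).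
    by rewrite /X; ring.
  by apply: mulr_ge0; [exact: draw_prob_ge0 | rewrite mulr_ge0 ?sqr_ge0].
rewrite !big_split /= -!mulr_sumr.
rewrite (mean_draw_sum q hn htau) (mean_draw_sum q hn htau).
rewrite !(mean_draw_sum_sqr q hn htau) (sum_draw_prob q hn htau) -/A -/H.
(* Since [theta] times [batch] is [n], the sampled sums are unbiased and the products of [y] and [h]
   cancel. *)
rewrite le_eqVlt; apply/orP; left; apply/eqP.
by rewrite /c /theta; field; rewrite n_neq0 b_neq0.
Qed.

Lemma mean_entry_step (a h : R) (j : 'I_n) :
  \sum_(S : {set 'I_n}) p S * (if j \in S then a else h) ^+ 2 =
  b / n%:R * a ^+ 2 + (1 - b / n%:R) * h ^+ 2.
Proof.
rewrite (eq_bigr (fun S => h ^+ 2 * p S + (a ^+ 2 - h ^+ 2) * (p S * (j \in S)%:R))).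
  rewrite big_split /= -!mulr_sumr (prob_mem q hn htau) (sum_draw_prob q hn htau); ring.
by move=> S _; case: (j \in S) => /=; ring.
Qed.

(** If th^2 P2 - 1 is nonpositive, the term in H^2 is dropped; otherwise H^2 is replaced by its
    bound n X. These are the two cases of [rho]. *)
Lemma rho_bound (X H : R) : 0 <= X -> H ^+ 2 <= n%:R * X ->
  (th / n%:R) ^+ 2 * ((b / n%:R - P2) * X + P2 * H ^+ 2) - (n%:R^-1 * H) ^+ 2 <=
  rho n q tau / n%:R ^+ 2 * X.
Proof.
move=> X0 HX.
set r := th ^+ 2 * ((1 - q) / n%:R +
    q * (tau%:R / n%:R) * ((n%:R - tau%:R) / (n%:R - 1))).
have rE : r = th ^+ 2 * (b / n%:R - P2).
  by rewrite /r /batch /pair_prob; congr (_ * _); field; rewrite n_neq0 n1_neq0.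
have -> : (th / n%:R) ^+ 2 * ((b / n%:R - P2) * X + P2 * H ^+ 2) - (n%:R^-1 * H) ^+ 2 =
   (r * X + (th ^+ 2 * P2 - 1) * H ^+ 2) / n%:R ^+ 2.
  by rewrite rE; field.
rewrite [leRHS]mulrAC ler_pM2r ?invr_gt0 ?exprn_gt0 ?ltr0n ?(ltnW hn) //.
rewrite /rho -/r (_ : th ^+ 2 * q * (tau%:R / n%:R) * ((tau%:R - 1) / (n%:R - 1)) =
  th ^+ 2 * P2); last by rewrite /pair_prob; field; rewrite n_neq0 n1_neq0.
have n1 : 0 < n%:R - 1 :> R by move: n_ge2; lra.
have n0 : 0 < n%:R :> R by move: n_ge2; lra.
(* The threshold of [rho] is this sign condition; at [tau] = 1 the pair probability is 0, in
   accordance with an infinite threshold. *)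
have -> : ((tau == 1%N) ||
    (q * th ^+ 2 <= n%:R / tau%:R * ((n%:R - 1) / (tau%:R - 1)))) = (th ^+ 2 * P2 <= 1).
  have [t1|t1] /= := eqVneq tau 1%N.
    by rewrite /pair_prob t1 subrr !mulr0 mul0r mulr0 ler01.
  have tau_gt1 : 0 < tau%:R - 1 :> R.
    by rewrite subr_gt0 ltr1n; move: htau t1; case: (tau) => [//|[|]].
  have tau0 : 0 < tau%:R :> R by move: tau_gt1; lra.
  rewrite mulf_div ler_pdivlMr ?mulr_gt0 // /pair_prob mulrA ler_pdivrMr ?mulr_gt0 //.
  by rewrite mul1r mulrA (mulrC _ q).
case: ifP => [c1|/negbT]; last rewrite -ltNge => c1.
  by rewrite gerDl mulr_le0_ge0 ?sqr_ge0 // subr_le0.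
rewrite [leRHS]mulrDl lerD2l -[leRHS]mulrA [leRHS]mulrCA ler_wpM2l //.
by rewrite subr_ge0 ltW.
Qed.

End StepMoments.

(** * Consequences of the step size rule *)

Section StepSize.
Variables (R : realType) (n : nat) (L : 'I_n -> R) (mu q : R) (tau : nat).
Hypotheses (hn : (2 <= n)%N) (hq : 0 <= q <= 1) (htau : (1 <= tau <= n)%N).
Hypotheses (mu_gt0 : 0 < mu) (mL_gt0 : 0 < mean L) (mL_le : mean L <= Lmax L).

Local Notation b := (batch q tau).
Local Notation P2 := (pair_prob n q tau).
Local Notation th := (theta n q tau).
Local Notation E1 := (expected_smoothness L q tau).
Local Notation al := (stepsize L mu q tau).
Local Notation rh := (rho n q tau).

Let n_ge2 : 2 <= n%:R :> R. Proof. by rewrite ler_nat. Qed.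
Let n_gt0 : 0 < n%:R :> R. Proof. by move: n_ge2; lra. Qed.
Let n_neq0 : n%:R != 0 :> R. Proof. by rewrite gt_eqF. Qed.
Let n1_neq0 : n%:R - 1 != 0 :> R. Proof. by apply/eqP; move: n_ge2; lra. Qed.
Let b_gt0 : 0 < b.
Proof. exact: lt_le_trans (batch_ge1 hq htau). Qed.
Let b_neq0 : b != 0. Proof. by rewrite gt_eqF. Qed.
Let Lmax_gt0 : 0 < Lmax L. Proof. exact: lt_le_trans mL_le. Qed.
Let th_ge1 : 1 <= th. Proof. exact: theta_ge1. Qed.

(** Exhibits the two weights of [mean_draw_sum_sqr], one paired with the maximal and one with the
    mean smoothness constant. *)
Lemma expected_smoothnessE :
  E1 = (b ^+ 2)^-1 * (n%:R * (b / n%:R - P2) * Lmax L + n%:R ^+ 2 * P2 * mean L).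
Proof.
rewrite /expected_smoothness; congr (_ * _).
by rewrite /batch /pair_prob; field; rewrite n_neq0 n1_neq0.
Qed.

Lemma expected_smoothness_gt0 : 0 < E1.
Proof.
rewrite expected_smoothnessE mulr_gt0 ?invr_gt0 ?exprn_gt0 //.
have P2_0 : 0 <= P2 by exact: pair_prob_ge0.
have P2_le : P2 <= b / n%:R by exact: pair_prob_le.
apply: (@lt_le_trans _ _ ((n%:R * (b / n%:R - P2) + n%:R ^+ 2 * P2) * mean L)).
  rewrite mulr_gt0 // (_ : _ + _ = b + n%:R * (n%:R - 1) * P2).
    have n1 : 0 <= n%:R - 1 :> R by move: n_ge2; lra.
    apply: ltr_pwDl => //; exact: mulr_ge0 (mulr_ge0 (ltW n_gt0) n1) P2_0.
  by field.
by rewrite mulrDl lerD2r ler_wpM2l // mulr_ge0 ?(ltW n_gt0) // subr_ge0.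
Qed.

Lemma rho_ge0 : 0 <= rh.
Proof.
(* Testing the bound at these values gives the sign without splitting on the threshold. *)
have := rho_bound q hn htau (X := 1) (H := 0) ler01.
rewrite expr0n /= !mulr0 !mulr1 expr0n subr0 addr0 => /(_ (ltW n_gt0)).
have P2_le : P2 <= b / n%:R by exact: pair_prob_le.
move/(le_trans (mulr_ge0 (sqr_ge0 _) _)); rewrite subr_ge0 => /(_ P2_le).
by rewrite pmulr_lge0 // invr_gt0 exprn_gt0.
Qed.

Let den_gt0 : 0 < 4 * Lmax L * rh + mu * th * n%:R.
Proof.
have th0 : 0 < th by exact: lt_le_trans th_ge1.
apply: ltr_wpDl; last exact: mulr_gt0 (mulr_gt0 mu_gt0 th0) n_gt0.
by rewrite mulr_ge0 ?rho_ge0 // mulr_ge0 // ltW.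
Qed.

Lemma stepsize_gt0 : 0 < al.
Proof.
by rewrite /stepsize lt_min !divr_gt0 // mulr_gt0 // expected_smoothness_gt0.
Qed.

Lemma stepsize_smoothness : 4 * E1 * al <= 1.
Proof.
have E0 : 0 < 4 * E1 by apply: mulr_gt0 => //; exact: expected_smoothness_gt0.
by rewrite mulrC -ler_pdivlMr // /stepsize ge_min lexx.
Qed.

Lemma stepsize_rho : al * (4 * Lmax L * rh + mu * th * n%:R) <= n%:R.
Proof. by rewrite -ler_pdivlMr // /stepsize ge_min lexx orbT. Qed.

(** Keeps the contraction factor nonnegative; it follows from [stepsize_rho] because [theta] is at
    least 1. *)
Lemma stepsize_mu : al * mu <= 1.
Proof.
have al0 := stepsize_gt0; have := stepsize_rho.
have H : 0 <= al * (4 * Lmax L * rh).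
  by rewrite !mulr_ge0 // ?rho_ge0 // ?ltW.
move=> H2; rewrite -(ler_pM2r n_gt0) mul1r.
apply: le_trans H2; rewrite mulrDr -subr_ge0.
have -> : al * (4 * Lmax L * rh) + al * (mu * th * n%:R) - al * mu * n%:R =
  al * (4 * Lmax L * rh) + al * mu * n%:R * (th - 1) by ring.
by rewrite addr_ge0 // mulr_ge0 ?subr_ge0 // !mulr_ge0 // ltW.
Qed.

(** Inversion exchanges minimum and maximum of positive numbers. *)
Lemma stepsize_inv :
  Num.max (4 * E1 / mu) (th + 4 * rh * Lmax L / (mu * n%:R)) = (al * mu)^-1.
Proof.
have E0 := expected_smoothness_gt0.
have -> : 4 * E1 / mu = (1 / (4 * E1) * mu)^-1.
  by field; rewrite !gt_eqF.
have -> : th + 4 * rh * Lmax L / (mu * n%:R) =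
    (n%:R / (4 * Lmax L * rh + mu * th * n%:R) * mu)^-1.
  by field; rewrite n_neq0 !gt_eqF.
rewrite /stepsize minr_pMl ?ltW //.
set u := 1 / _ * mu; set v := n%:R / _ * mu.
have u0 : 0 < u by rewrite mulr_gt0 // divr_gt0 // mulr_gt0.
have v0 : 0 < v by rewrite mulr_gt0 // divr_gt0.
case: (leP u v) => uv; first by rewrite max_l // lef_pV2.
by rewrite max_r // lef_pV2 // ltW.
Qed.

(** The scalar core of the contraction: [D] is the gap, [SA] and [SH] are the summed squared norms
    of gradient differences and table errors, and [AA] is the squared norm of the summed gradient
    differences. *)
Lemma one_step_bound (EX EJ yy YA SA AA SH D : R) :
  0 <= D -> 0 <= SH ->
  EX <= yy - 2 * al * (n%:R^-1 * YA) +
    2 * al ^+ 2 * ((th / n%:R) ^+ 2 * ((b / n%:R - P2) * SA + P2 * AA)) +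
    2 * al ^+ 2 * (rh / n%:R ^+ 2 * SH) ->
  EJ = b / n%:R * SA + (1 - b / n%:R) * SH ->
  D + mu / 2 * yy <= n%:R^-1 * YA ->
  SA <= 2 * Lmax L * (n%:R * D) ->
  AA <= n%:R ^+ 2 * (2 * mean L * D) ->
  EX + th * al / (2 * n%:R * Lmax L) * EJ <=
  (1 - al * mu) * (yy + th * al / (2 * n%:R * Lmax L) * SH).
Proof.
move=> D0 SH0 hX -> hY hSA hAA.
have al0 := stepsize_gt0.
have P2_0 : 0 <= P2 by exact: pair_prob_ge0.
have P2_le : P2 <= b / n%:R by exact: pair_prob_le.
have hA : (th / n%:R) ^+ 2 * ((b / n%:R - P2) * SA + P2 * AA) <= 2 * E1 * D.
  apply: (@le_trans _ _ ((th / n%:R) ^+ 2 * ((b / n%:R - P2) * (2 * Lmax L * (n%:R * D)) +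
      P2 * (n%:R ^+ 2 * (2 * mean L * D))))).
    rewrite ler_wpM2l ?sqr_ge0 // lerD // ler_wpM2l // subr_ge0 //.
  rewrite le_eqVlt; apply/orP; left; apply/eqP.
  by rewrite expected_smoothnessE /theta; field; rewrite n_neq0 b_neq0.
set c := th * al / (2 * n%:R * Lmax L).
have th0 : 0 < th by exact: lt_le_trans th_ge1.
have d0 : 0 < 2 * n%:R * Lmax L by exact: mulr_gt0 (mulr_gt0 _ n_gt0) Lmax_gt0.
have c0 : 0 < c by apply: divr_gt0 => //; exact: mulr_gt0.
have cb : c * (b / n%:R) = al / (2 * n%:R * Lmax L).
  by rewrite /c /theta; field; rewrite n_neq0 b_neq0 gt_eqF.
(* The weight of the table term is tuned to this: the refreshed columns cost at most [al * D]. *)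
have hcA : c * (b / n%:R) * SA <= al * D.
  have -> : al * D = al / (2 * n%:R * Lmax L) * (2 * Lmax L * (n%:R * D)).
    by field; rewrite n_neq0 gt_eqF.
  by rewrite cb ler_wpM2l // divr_ge0 // ltW.
(* The difference of the two sides is a nonnegative multiple of the slack in [stepsize_rho]. *)
have hH : 2 * al ^+ 2 * (rh / n%:R ^+ 2) + c * (1 - b / n%:R) <= (1 - al * mu) * c.
  rewrite mulrBr cb -subr_ge0.
  have -> : (1 - al * mu) * c - (2 * al ^+ 2 * (rh / n%:R ^+ 2) +
       (c * 1 - al / (2 * n%:R * Lmax L))) =
     al / (2 * n%:R ^+ 2 * Lmax L) * (n%:R - al * (4 * Lmax L * rh + mu * th * n%:R)).
    by rewrite /c; field; rewrite n_neq0 gt_eqF.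
  apply: mulr_ge0; last by rewrite subr_ge0 stepsize_rho.
  apply: divr_ge0; first exact: ltW.
  by rewrite ltW // mulr_gt0 // mulr_gt0 // exprn_gt0.
have h1 := ler_wpM2l (ltW al0) hY.
have h2 := ler_wpM2l (sqr_ge0 al) hA.
have h3 := ler_wpM2r SH0 hH.
(* The sampled gradients cost the other [al * D]; with [hcA] this exhausts the decrease
   [2 * al * D]. *)
have h4 : al ^+ 2 * (4 * E1 * D) <= al * D.
  rewrite (_ : al ^+ 2 * (4 * E1 * D) = 4 * E1 * al * (al * D)); last by ring.
  by rewrite ler_piMl ?stepsize_smoothness // mulr_ge0 // ltW.
apply: (le_trans (lerD hX (lexx _))).
move: h1 h2 h3 h4 hcA.
set t1 := n%:R^-1 * YA; set t2 := (th / n%:R) ^+ 2 * _; set t3 := rh / _.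
set t4 := b / n%:R.

lra.
Qed.

End StepSize.

(** The sum of (n u_j - H)^2 equals n(n Q - H^2); n = 0 is set apart because the factor n is
    cancelled. *)
Lemma sqr_sum_le (R : realType) (n : nat) (u : 'I_n -> R) :
  (\sum_j u j) ^+ 2 <= n%:R * \sum_j u j ^+ 2.
Proof.
case: n u => [|n] u; first by rewrite !big_ord0 expr0n mulr0.
set H := \sum_j u j; set Q := \sum_j u j ^+ 2.
have : 0 <= \sum_j (n.+1%:R * u j - H) ^+ 2 by apply: sumr_ge0 => j _; exact: sqr_ge0.
rewrite (eq_bigr (fun j => n.+1%:R ^+ 2 * u j ^+ 2 + (- (2 * n.+1%:R * H) * u j + H ^+ 2))).
  rewrite !big_split /= sumr_const card_ord -!mulr_sumr -/H -/Q -[H ^+ 2 *+ _]mulr_natl.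
  rewrite (_ : _ + _ = n.+1%:R * (n.+1%:R * Q - H ^+ 2)); last by ring.
  by rewrite pmulr_rge0 ?ltr0n // subr_ge0.
by move=> j _; ring.
Qed.

Lemma mx_entryB (R : realType) (m n : nat) (A B : 'M[R]_(m, n)) i j :
  (A - B) i j = A i j - B i j.
Proof. by rewrite !mxE. Qed.

Lemma mx_entryD (R : realType) (m n : nat) (A B : 'M[R]_(m, n)) i j :
  (A + B) i j = A i j + B i j.
Proof. by rewrite !mxE. Qed.

Lemma mx_entryZ (R : realType) (m n : nat) (c : R) (A : 'M[R]_(m, n)) i j :
  (c *: A) i j = c * A i j.
Proof. by rewrite !mxE. Qed.

(** * The finite sum, its gradient and its minimizer *)

Definition grad_avg (R : realType) (d n : nat) (f : 'I_n -> 'cV[R]_d -> R)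
    (x : 'cV[R]_d) : 'cV[R]_d :=
  n%:R^-1 *: \sum_i grad (f i) x.

Definition grad_diff (R : realType) (d n : nat) (f : 'I_n -> 'cV[R]_d -> R)
    (xs x : 'cV[R]_d) (i : 'I_n) : 'cV[R]_d :=
  grad (f i) x - grad (f i) xs.

Section FiniteSum.
Variables (R : realType) (d n : nat) (f : 'I_n -> 'cV[R]_d -> R) (L : 'I_n -> R) (mu : R).
Hypotheses (n_gt0 : (0 < n)%N).
Hypotheses (f_convex : forall i, convex_function setT (f i))
  (f_smooth : forall i, smooth (L i) (f i))
  (mu_gt0 : 0 < mu) (f_strongly_convex : strongly_convex mu (favg f)).

Local Notation grad_avg := (grad_avg f).

Let f_grad i : has_grad (f i) (grad (f i)).
Proof. by apply: differentiable_has_grad; case: (f_smooth i). Qed.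

Let f_tangent i u w : f i w + dot (grad (f i) w) (u - w) <= f i u.
Proof.
(* Convexity is strong convexity of modulus 0. *)
have C : strongly_convex 0 (f i).
  move=> x y t /andP[t0 t1].
  have := f_convex i (Itv01 t0 t1) (x := x) (y := y) (in_setT _) (in_setT _).
  by rewrite convRE /= !mul0r subr0.
by have := strongly_convex_grad w u (@f_grad i) C; rewrite !mul0r addr0.
Qed.

Let f_descent i u w :
  f i u <= f i w + dot (grad (f i) w) (u - w) + L i / 2 * dot (u - w) (u - w).
Proof. by apply: descent_lemma => //; case: (f_smooth i). Qed.

Lemma has_grad_favg : has_grad (favg f) grad_avg.
Proof.
move=> x v; rewrite dotZl dot_suml.
have -> : favg f = n%:R^-1 \*: (\sum_i f i).
  by apply/funext => y; rewrite /favg /mean /= fct_sumE.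
exact: is_deriveZ (is_derive_sum (fun i => f_grad i x v)).
Qed.

Lemma favg_tangent u w :
  favg f w + dot (grad_avg w) (u - w) + mu / 2 * dot (u - w) (u - w) <= favg f u.
Proof. exact: strongly_convex_grad has_grad_favg _. Qed.

(** Averaging the individual descent inequalities yields the constant [mean L]. *)
Lemma favg_descent u w :
  favg f u <= favg f w + dot (grad_avg w) (u - w) + mean L / 2 * dot (u - w) (u - w).
Proof.
rewrite /favg /mean dotZl dot_suml -mulrA -mulrA -!mulrDr.
rewrite mulr_suml -!big_split ler_wpM2l ?invr_ge0 ?ler0n //.
by apply: ler_sum => i _ /=; rewrite mulrA.
Qed.

Lemma mean_le_Lmax : mean L <= Lmax L.
Proof.
rewrite /mean mulrC ler_pdivrMr ?ltr0n // mulr_natr -[X in _ *+ X](card_ord n) -sumr_const.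
by apply: ler_sum => i _; exact: le_bigmax.
Qed.

(** The quadratic lower and upper bounds at a nonzero vector force [mu] to be at most [mean L]. *)
Lemma mean_L_gt0 : (0 < d)%N -> 0 < mean L.
Proof.
move=> d_gt0; pose v : 'cV[R]_d := const_mx 1.
have v0 : 0 < dot v v.
  rewrite lt_def dot_ge0 dot_eq0 andbT; apply/eqP => /matrixP /(_ (Ordinal d_gt0) 0).
  by rewrite !mxE => /eqP; rewrite oner_eq0.
have := le_trans (favg_tangent v 0) (favg_descent v 0).
rewrite subr0 lerD2l ler_pM2r // ler_pM2r //.
exact: lt_le_trans.
Qed.


Section Minimizer.
Variable xs : 'cV[R]_d.
Hypotheses (d_gt0 : (0 < d)%N) (xs_min : forall x, favg f xs <= favg f x).

Let mL_gt0 : 0 < mean L. Proof. exact: mean_L_gt0. Qed.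
Let Lmax_gt0 : 0 < Lmax L. Proof. exact: lt_le_trans mean_le_Lmax. Qed.
Let nR_neq0 : n%:R != 0 :> R. Proof. by rewrite pnatr_eq0 -lt0n. Qed.

(** A gradient step of length 1/[mean L] from [xs] would lower [favg f] unless the gradient
    vanished. *)
Lemma grad_avg_min : grad_avg xs = 0.
Proof.
apply/eqP; rewrite -dot_eq0 eq_le dot_ge0 andbT.
have := le_trans (xs_min _) (favg_descent (xs - (mean L)^-1 *: grad_avg xs) xs).
rewrite [xs - _ - _]addrAC subrr add0r; move: (grad_avg xs) => g.
rewrite !dotNr dotNl !dotZr dotZl opprK.
set s := dot _ _.
have -> : mean L / 2 * ((mean L)^-1 * ((mean L)^-1 * s)) = (mean L)^-1 * s / 2.
  by field; rewrite gt_eqF.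
move=> H; rewrite -(pmulr_rle0 _ (_ : 0 < (mean L)^-1)) ?invr_gt0 //; lra.
Qed.

Lemma sum_grad_min : \sum_i grad (f i) xs = 0.
Proof.
have /eqP := grad_avg_min; rewrite /grad_avg scaler_eq0 invr_eq0 (negPf nR_neq0) /=.
by move=> /eqP.
Qed.

Local Notation a := (grad_diff f xs).

Lemma sum_grad_diff x : \sum_i a x i = n%:R *: grad_avg x.
Proof. by rewrite sumrB sum_grad_min subr0 /grad_avg scalerA mulfV // scale1r. Qed.

(** The linear terms cancel in the sum because the gradients at [xs] add up to 0. *)
Lemma sum_sqr_grad_diff x :
  \sum_i dot (a x i) (a x i) <= 2 * Lmax L * (n%:R * (favg f x - favg f xs)).
Proof.
have -> : n%:R * (favg f x - favg f xs) =
    \sum_i (f i x - f i xs - dot (grad (f i) xs) (x - xs)).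
  rewrite !sumrB -dot_suml sum_grad_min dot0l subr0.
  by rewrite mulrBr /favg /mean !mulrA mulfV // !mul1r.
rewrite mulr_sumr; apply: ler_sum => i _; apply: cocoercive => // u w.
(* Each [L i] is relaxed to [Lmax L], which is positive even if some [L i] vanish. *)
apply: (le_trans (f_descent i u w)).
by rewrite lerD2l ler_wpM2r ?dot_ge0 // ler_pM2r // le_bigmax.
Qed.

Lemma sqr_sum_grad_diff x : dot (\sum_i a x i) (\sum_i a x i) <=
  n%:R ^+ 2 * (2 * mean L * (favg f x - favg f xs)).
Proof.
rewrite sum_grad_diff dotZl dotZr mulrA -expr2 ler_wpM2l ?sqr_ge0 //.
have := @cocoercive _ _ (mean L) (favg f) grad_avg x xs mL_gt0.
rewrite grad_avg_min subr0 dot0l subr0; apply.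
  move=> u w; apply: le_trans (favg_tangent u w).
  by rewrite lerDl mulr_ge0 ?dot_ge0 // divr_ge0 // ltW.
exact: favg_descent.
Qed.

Lemma gap_le_slope x : favg f x - favg f xs + mu / 2 * dot (x - xs) (x - xs) <=
  n%:R^-1 * dot (x - xs) (\sum_i a x i).
Proof.
have := favg_tangent xs x; rewrite sum_grad_diff dotZr mulrA mulVf // mul1r.
rewrite -(opprB x xs) !dotNr dotNl opprK dotC; lra.
Qed.

(** * Contraction of the Lyapunov function in one step *)

Section Contraction.
Variables (q : R) (tau : nat).
Hypotheses (hn : (2 <= n)%N) (hq : 0 <= q <= 1) (htau : (1 <= tau <= n)%N).
Local Notation p := (draw_prob q tau : {set 'I_n} -> R).
Local Notation b := (batch q tau).
Local Notation P2 := (pair_prob n q tau).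
Local Notation th := (theta n q tau).
Local Notation al := (stepsize L mu q tau).
Local Notation Psi := (lyapunov f L q tau al xs).

Lemma mean_lyapunov_step (s : 'cV[R]_d * 'M[R]_(d, n)) :
  \sum_(S : {set 'I_n}) p S * Psi (sagd_step f q tau al s S) <= (1 - al * mu) * Psi s.
Proof.
case: s => x J; rewrite /lyapunov /=.
set c := th * al / (2 * n%:R * Lmax L).
under eq_bigr do rewrite mulrDr (mulrCA _ c).
rewrite big_split /= -mulr_sumr.
pose A i := a x i; pose h (i : 'I_n) := col i J - grad (f i) xs.
pose y := x - xs.
(* Centring the columns at the gradients at [xs] does not change their sum. *)
have sumh r : \sum_j h j r 0 = \sum_j J r j.
  have sg0 : \sum_j grad (f j) xs r 0 = 0.
    by have := congr1 (fun v : 'cV[R]_d => v r 0) sum_grad_min; rewrite summxE mxE.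
  transitivity (\sum_j (J r j - grad (f j) xs r 0)); last by rewrite sumrB sg0 subr0.
  by apply: eq_bigr => j _; rewrite /h mx_entryB mxE.
have -> : fnorm (J - gradF f xs) ^+ 2 = \sum_j dot (h j) (h j).
  rewrite fnorm_sqr exchange_big; apply: eq_bigr => j _; apply: eq_bigr => r _.
  rewrite -expr2; congr (_ ^+ 2).
  by rewrite /h !mx_entryB !mxE.
rewrite fnorm_dot -/y.
have D0 : 0 <= favg f x - favg f xs by rewrite subr_ge0.
have SH0 : 0 <= \sum_j dot (h j) (h j) by apply: sumr_ge0 => j _; exact: dot_ge0.
apply: (one_step_bound hn hq htau mu_gt0 mL_gt0 mean_le_Lmax D0 SH0 _ _
  (gap_le_slope x) (sum_sqr_grad_diff x) (sqr_sum_grad_diff x)).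
  (* Coordinates of the new offset: a sampled gradient minus its column is [A j - h j]. *)
  pose X (S : {set 'I_n}) r := y r 0 - al *
    (th / n%:R * (\sum_(j in S) (A j r 0 - h j r 0)) + n%:R^-1 * \sum_j h j r 0).
  apply: (@le_trans _ _ (\sum_r \sum_(S : {set 'I_n}) p S * X S r ^+ 2)).
    rewrite exchange_big le_eqVlt; apply/orP; left; apply/eqP.
    apply: eq_bigr => S _; rewrite -mulr_sumr fnorm_dot; congr (_ * _).
    apply: eq_bigr => r _; rewrite -expr2; congr (_ ^+ 2).
    rewrite /X /y !mx_entryB mx_entryZ mx_entryD !mx_entryZ !summxE sumh.
    rewrite addrAC; congr (_ - al * (_ * _ + _ * _)).
      by apply: eq_bigr => j _; rewrite /A /h /grad_diff !mx_entryB; ring.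
    by apply: eq_bigr => j _; rewrite mxE.
  pose Z r := y r 0 ^+ 2 - 2 * al * (n%:R^-1 * (y r 0 * \sum_j A j r 0)) +
    2 * al ^+ 2 * ((th / n%:R) ^+ 2 *
       ((b / n%:R - P2) * (\sum_j A j r 0 ^+ 2) + P2 * (\sum_j A j r 0) ^+ 2)) +
    2 * al ^+ 2 * (rho n q tau / n%:R ^+ 2 * \sum_j h j r 0 ^+ 2).
  apply: (@le_trans _ _ (\sum_r Z r)).
    apply: ler_sum => r _; apply: le_trans.
      exact: (mean_coord_step hn hq htau (y r 0) al (fun j => A j r 0) (fun j => h j r 0)).
    rewrite lerD2l ler_wpM2l ?(mulr_ge0 (ler0n _ 2) (sqr_ge0 al)) //.
    apply: (rho_bound q hn htau); first by apply: sumr_ge0 => j _; exact: sqr_ge0.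
    exact: sqr_sum_le.
  have -> : dot (\sum_i a x i) (\sum_i a x i) = \sum_r (\sum_j A j r 0) ^+ 2.
    by apply: eq_bigr => r _; rewrite summxE expr2.
  have -> : dot (x - xs) (\sum_i a x i) = \sum_r y r 0 * \sum_j A j r 0.
    by apply: eq_bigr => r _; rewrite summxE.
  have -> : \sum_i dot (a x i) (a x i) = \sum_r \sum_j A j r 0 ^+ 2.
    by rewrite exchange_big; apply: eq_bigr => i _; apply: eq_bigr => r _; rewrite expr2.
  have -> : \sum_j dot (h j) (h j) = \sum_r \sum_j h j r 0 ^+ 2.
    by rewrite exchange_big; apply: eq_bigr => i _; apply: eq_bigr => r _; rewrite expr2.
  have -> : dot (x - xs) (x - xs) = \sum_r y r 0 ^+ 2.
    by apply: eq_bigr => r _; rewrite expr2.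
  by rewrite /Z !big_split /= sumrN -!mulr_sumr big_split /= -!mulr_sumr.
(* For the table, the new error of a column is [A j] if refreshed and [h j] otherwise. *)
rewrite (eq_bigr (fun S => \sum_r \sum_j p S *
    (if j \in S then A j r 0 else h j r 0) ^+ 2)); last first.
  move=> S _; rewrite fnorm_sqr mulr_sumr; apply: eq_bigr => r _.
  rewrite mulr_sumr; apply: eq_bigr => j _; congr (_ * _ ^+ 2).
  rewrite mx_entryB !mxE /A /h /grad_diff; case: ifP => _; rewrite ?mx_entryB // !mxE.
rewrite exchange_big /=.
under eq_bigr do rewrite exchange_big /=.
under eq_bigr do under eq_bigr do rewrite (mean_entry_step q hn htau).
rewrite exchange_big /= !mulr_sumr -big_split /=; apply: eq_bigr => j _.
rewrite !mulr_sumr -big_split; apply: eq_bigr => r _ /=.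
by rewrite !expr2.
Qed.

End Contraction.
End Minimizer.
End FiniteSum.

(** * Independent draws and the iteration count *)

Lemma Edraws_cons (R : realType) (n : nat) (q : R) (tau k : nat)
    (X : k.+1.-tuple {set 'I_n} -> R) :
  Edraws q tau X = \sum_(S : {set 'I_n}) draw_prob q tau S *
    Edraws q tau (fun s : k.-tuple {set 'I_n} => X [tuple of S :: s]).
Proof.
rewrite /Edraws; under [RHS]eq_bigr do rewrite mulr_sumr.
rewrite pair_big /=.
rewrite (reindex (fun z : {set 'I_n} * k.-tuple {set 'I_n} => [tuple of z.1 :: z.2])) /=.
  apply: eq_bigr => -[S s] _ /=; rewrite big_ord_recl tnth0 mulrA.
  by congr (_ * _ * _); apply: eq_bigr => i _; rewrite tnthS.
exists (fun s : k.+1.-tuple _ => (thead s, [tuple of behead s])) => [[S s]|s] _ /=.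
  by congr pair; apply: val_inj.
by rewrite [RHS]tuple_eta.
Qed.

(** Conditioning on the first draw, which [foldl] consumes first, leaves [k] draws from a new state;
    hence the induction over all starting states. *)
Lemma Edraws_foldl_le (R : realType) (n : nat) (q : R) (tau : nat)
    (hq : 0 <= q <= 1) (T : Type) (step : T -> {set 'I_n} -> T) (Psi : T -> R) (r : R) :
  0 <= r ->
  (forall s, \sum_(S : {set 'I_n}) draw_prob q tau S * Psi (step s S) <= r * Psi s) ->
  forall k s, Edraws q tau (fun w : k.-tuple {set 'I_n} => Psi (foldl step s w))
    <= r ^+ k * Psi s.
Proof.
move=> r0 H; elim=> [|k IH] s.
  rewrite /Edraws (big_pred1 [tuple]) => [|w]; first by rewrite big_ord0 !mul1r.
  by apply/esym/eqP; exact: tuple0.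
rewrite Edraws_cons /=.
apply: (@le_trans _ _ (\sum_(S : {set 'I_n}) draw_prob q tau S * (r ^+ k * Psi (step s S)))).
  by apply: ler_sum => S _; rewrite ler_wpM2l ?draw_prob_ge0.
rewrite (eq_bigr (fun S => r ^+ k * (draw_prob q tau S * Psi (step s S)))).
  by rewrite -mulr_sumr exprSr -mulrA ler_wpM2l ?exprn_ge0.
by move=> S _; rewrite mulrCA.
Qed.

Theorem theorem2 (R : realType) (d n : nat) (hn : (2 <= n)%N)
    (f : 'I_n -> 'cV[R]_d -> R) (L : 'I_n -> R) (mu : R)
    (f_convex : forall i, convex_function setT (f i))
    (f_smooth : forall i, smooth (L i) (f i))
    (mu_gt0 : 0 < mu) (f_strongly_convex : strongly_convex mu (favg f))
    (xs : 'cV[R]_d) (xs_min : forall x, favg f xs <= favg f x)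
    (q : R) (hq : 0 <= q <= 1) (tau : nat) (htau : (1 <= tau <= n)%N)
    (x0 : 'cV[R]_d) (J0 : 'M[R]_(d, n))
    (alpha : R) (halpha : alpha = stepsize L mu q tau)
    (eps : R) (heps : 0 < eps) :
  expected_grads n q tau = q * (tau%:R - 1) + 1 /\
  (forall k : nat,
    Omega L mu q tau eps <= expected_total_complexity n q tau k ->
    expected_lyapunov f L q tau alpha xs x0 J0 k
      <= eps * lyapunov f L q tau alpha xs (x0, J0)).
Proof.
have hb : expected_grads n q tau = batch q tau.
  by rewrite /expected_grads (sum_draw_prob_card q hn htau (fun m => m%:R)) /batch; ring.
split; first by rewrite hb.
move=> k; rewrite /expected_total_complexity hb /Omega => hk.
(* In dimension 0 the Lyapunov function vanishes; positivity of [mean L] requires d > 0. *)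
have [d0|d_gt0] := posnP d.
  have lyap0 s : lyapunov f L q tau alpha xs s = 0.
    rewrite /lyapunov !fnorm_sqr; subst d.
    by rewrite !big_ord0 mulr0 addr0.
  rewrite /expected_lyapunov /Edraws lyap0 mulr0 big1 // => s _.
  by rewrite lyap0 mulr0.
have n_gt0 : (0 < n)%N by exact: ltnW.
have mL_gt0 := mean_L_gt0 f_smooth mu_gt0 f_strongly_convex d_gt0.
have mL_le := mean_le_Lmax L n_gt0.
have b_gt0 : 0 < batch q tau := lt_le_trans ltr01 (batch_ge1 hq htau).
have al0 : 0 < alpha * mu.
  by rewrite halpha mulr_gt0 // stepsize_gt0.
have al1 : 0 <= 1 - alpha * mu by rewrite subr_ge0 halpha stepsize_mu.
(* Cancelling [batch] leaves ln(1/eps)/(alpha mu) as lower bound on [k]. *)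
move: hk; rewrite stepsize_inv // -halpha (mulrC k%:R) -mulrA ler_pM2l // => hk.
rewrite /expected_lyapunov /sagd_iter.
apply: (@le_trans _ _ ((1 - alpha * mu) ^+ k * lyapunov f L q tau alpha xs (x0, J0))).
  apply: (@Edraws_foldl_le R n q tau hq _ (sagd_step f q tau alpha)
    (lyapunov f L q tau alpha xs)) => // s.
  by rewrite halpha; exact: mean_lyapunov_step.
apply: ler_wpM2r.
  rewrite /lyapunov addr_ge0 ?sqr_ge0 // mulr_ge0 ?sqr_ge0 //.
  have th0 : 0 < theta n q tau := lt_le_trans ltr01 (theta_ge1 hq htau).
  apply: divr_ge0; first by rewrite ltW // mulr_gt0 // halpha stepsize_gt0.
  have nR_gt0 : 0 < n%:R :> R by rewrite ltr0n.
  exact: ltW (mulr_gt0 (mulr_gt0 (ltr0Sn _ 1) nR_gt0) (lt_le_trans mL_gt0 mL_le)).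
(* From 1 - t <= exp(-t), it remains to compare exponents. *)
apply: (@le_trans _ _ (expR (- (alpha * mu)) ^+ k)).
  by rewrite lerXn2r ?nnegrE ?expR_ge0 // expR_ge1Dx.
rewrite -expRM_natl -[leRHS](@lnK _ eps) ?posrE // ler_expR.
move: hk; rewrite div1r lnV ?posrE // ler_pdivrMl //; lra.
Qed.
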